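(* Let $\Delta$ and $\Delta'$ be two simplicial complexes with disjoint vertex sets. Then $$H_{\mathbb{K}[\Delta\cup\Delta']}(t)=H_{\mathbb{K}[\Delta]}(t)+H_{\mathbb{K}[\Delta']}(t)-1.$$
   Context: $\mathbb{K}$ is a field. For a simplicial complex $\Delta$ on a finite vertex set $\{x_1,\dots,x_n\}$, the Stanley-Reisner ring is $\mathbb{K}[\Delta]=\mathbb{K}[x_1,\dots,x_n]/I_\Delta$, where $I_\Delta$ is generated by the monomials $x_F=\prod_{x_i\in F}x_i$ with $F\notin\Delta$. $H_{\mathbb{K}[\Delta]}(t)$ denotes its Hilbert series with respect to the standard grading. For complexes with vertex sets $V,V'$, the union $\Delta\cup\Delta'$ is the complex on $V\cup V'$ whose faces are the sets that are faces of $\Delta$ or of $\Delta'$. *)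

(* Defs.v *)
From HB Require Import structures.
From mathcomp Require Import all_boot all_order all_algebra.
From mathcomp Require Import finmap boolp mpoly.

Set Implicit Arguments.
Unset Strict Implicit.
Unset Printing Implicit Defensive.

Import GRing.Theory.
Local Open Scope ring_scope.
Local Open Scope quotient_scope.

(* Formal power series R[[t]], as coefficient sequences: [f d] is the
   coefficient of t^d. *)
Definition fps (R : comNzRingType) := nat -> R.

Section FormalPowerSeries.
Variable R : comNzRingType.
Implicit Types f g h : fps R.

HB.instance Definition _ := gen_eqMixin (fps R).
HB.instance Definition _ := gen_choiceMixin (fps R).

Definition fps_zero : fps R := fun=> 0.
Definition fps_one : fps R := fun d => (d == 0%N)%:R.
Definition fps_opp f : fps R := fun d => - f d.
Definition fps_add f g : fps R := fun d => f d + g d.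
Definition fps_mul f g : fps R := fun d => \sum_(i < d.+1) f i * g (d - i)%N.

Fact fps_addA : associative fps_add.
Proof. by move=> f g h; apply/funext => d; rewrite /fps_add addrA. Qed.
Fact fps_addC : commutative fps_add.
Proof. by move=> f g; apply/funext => d; rewrite /fps_add addrC. Qed.
Fact fps_add0 : left_id fps_zero fps_add.
Proof. by move=> f; apply/funext => d; rewrite /fps_add add0r. Qed.
Fact fps_addN : left_inverse fps_zero fps_opp fps_add.
Proof. by move=> f; apply/funext => d; rewrite /fps_add addNr. Qed.

HB.instance Definition _ :=
  GRing.isZmodule.Build (fps R) fps_addA fps_addC fps_add0 fps_addN.

Lemma fps_mul_trunc n f g d : (d < n)%N ->
  fps_mul f g d = (\poly_(i < n) f i * \poly_(i < n) g i)`_d.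
Proof.
move=> dn; rewrite coefM; apply: eq_bigr => i _.
have idn : (i < n)%N by apply: leq_trans dn; rewrite ltnS -ltnS.
by rewrite !coef_poly idn (leq_ltn_trans (leq_subr _ _) dn).
Qed.

Fact fps_mulC : commutative fps_mul.
Proof.
by move=> f g; apply/funext => d; rewrite !(fps_mul_trunc _ _ (ltnSn d)) mulrC.
Qed.
Fact fps_mulA : associative fps_mul.
Proof.
move=> f g h; apply/funext => d.
pose P f := \poly_(i < d.+1) f i : {poly R}.
transitivity (P f * P g * P h)`_d.
  rewrite -mulrA coefM; apply: eq_bigr => i _.
  have lid : (d - i < d.+1)%N by rewrite ltnS leq_subr.
  by rewrite (fps_mul_trunc _ _ lid) coef_poly ltn_ord.
rewrite coefM; apply: eq_bigr => i _.
by rewrite (fps_mul_trunc _ _ (ltn_ord i)) coef_poly ltnS leq_subr.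
Qed.
Fact fps_mul1 : left_id fps_one fps_mul.
Proof.
move=> f; apply/funext => d; rewrite /fps_mul big_ord_recl mul1r subn0.
by rewrite big1 ?addr0 // => i _; rewrite mul0r.
Qed.
Fact fps_mulDl : left_distributive fps_mul fps_add.
Proof.
move=> f g h; apply/funext => d; rewrite /fps_mul /fps_add -big_split /=.
by apply: eq_bigr => i _; rewrite mulrDl.
Qed.
Fact fps_one_neq0 : fps_one != 0.
Proof.
by apply/eqP => /(congr1 (fun f : fps R => f 0%N)) /eqP; rewrite oner_eq0.
Qed.

HB.instance Definition _ := GRing.Zmodule_isComNzRing.Build (fps R)
  fps_mulA fps_mulC fps_mul1 fps_mulDl fps_one_neq0.

End FormalPowerSeries.

(* Dimension of a subspace [W] of a possibly infinite-dimensional space; it is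
   0 by convention when [W] has no finite basis. *)
Section Dimension.
Variables (K : fieldType) (M : lmodType K).
Implicit Type W : M -> Prop.

Definition is_basis W n (b : 'I_n -> M) : Prop :=
  [/\ forall i, W (b i),
      forall c : 'I_n -> K, \sum_i c i *: b i = 0 -> forall i, c i = 0
    & forall w, W w -> exists c : 'I_n -> K, w = \sum_i c i *: b i].

Definition has_dim W n : Prop := exists b : 'I_n -> M, is_basis W b.

Definition dim W : nat :=
  if pselect (exists n, has_dim W n) is left ex then projT1 (cid ex) else 0%N.

Lemma has_dim_leq W m n : has_dim W m -> has_dim W n -> (m <= n)%N.
Proof.
move=> [b [Wb fb _]] [b' [_ _ sb']].
have /(_ _)/cid c_ i := sb' _ (Wb i).
pose A := \matrix_(i < m, j < n) projT1 (c_ i) j.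
have bE i : b i = \sum_j A i j *: b' j.
  by rewrite {1}(projT2 (c_ i)); apply: eq_bigr => j _; rewrite mxE.
suff : row_free A by rewrite /row_free => /eqP <-; apply: rank_leq_col.
apply/inj_row_free => v vA; apply/rowP => i; rewrite mxE.
apply: (fb (v 0)) => {i}; under eq_bigr => i _ do rewrite bE scaler_sumr.
rewrite exchange_big /= big1 // => j _.
under eq_bigr => i _ do rewrite scalerA.
rewrite -scaler_suml; have /matrixP/(_ 0 j) := vA.
by rewrite !mxE => ->; rewrite scale0r.
Qed.

Lemma dimE W n : has_dim W n -> dim W = n.
Proof.
move=> Wn; rewrite /dim; case: pselect => [ex|[]]; last by exists n.
by case: cid => m Wm /=; apply/eqP; rewrite eqn_leq !(@has_dim_leq W).
Qed.

End Dimension.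

(* Vertices lie in an arbitrary choiceType; a vertex [v] is not required to
   satisfy [set v] \in faces. The empty set is always a face, so the void
   complex is excluded. *)
Record simplicial_complex (T : choiceType) := SimplicialComplex {
  vertices : {fset T};
  faces : {fset {fset T}};
  faces_vertices : forall F, F \in faces -> (F `<=` vertices)%fset;
  faces_fset0 : fset0 \in faces;
  faces_closed : forall F G, F \in faces -> (G `<=` F)%fset -> G \in faces
}.

Section Union.
Variables (T : choiceType) (D D' : simplicial_complex T).

Fact union_faces_vertices F : F \in (faces D `|` faces D')%fset ->
  (F `<=` vertices D `|` vertices D')%fset.
Proof.
rewrite in_fsetU => /orP[] /faces_vertices sF; apply: fsubset_trans sF _.
  exact: fsubsetUl.
exact: fsubsetUr.
Qed.
Fact union_faces_fset0 : fset0 \in (faces D `|` faces D')%fset.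
Proof. by rewrite in_fsetU faces_fset0. Qed.
Fact union_faces_closed F G : F \in (faces D `|` faces D')%fset ->
  (G `<=` F)%fset -> G \in (faces D `|` faces D')%fset.
Proof.
by rewrite !in_fsetU => /orP[] FD GF; rewrite (faces_closed FD GF) ?orbT.
Qed.

Definition complex_union : simplicial_complex T :=
  SimplicialComplex union_faces_vertices union_faces_fset0 union_faces_closed.

End Union.

Section StanleyReisner.
Variables (K : fieldType) (T : choiceType) (D : simplicial_complex T).

(* K[x_v : v in vertices D]; the variable attached to the vertex [v] is
   ['X_(enum_rank v)]. *)
Definition vertex_poly := {mpoly K[#|{: vertices D}|]}.

Definition face_monomial (F : {fset T}) : vertex_poly :=
  \prod_(v : vertices D | val v \in F) 'X_(enum_rank v).

Definition nonfaces : seq {fset T} :=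
  [seq F <- fpowerset (vertices D) | F \notin faces D].

Definition sr_ideal : {pred vertex_poly} := fun p =>
  `[< exists c : {fset T} -> vertex_poly,
        p = \sum_(F <- nonfaces) c F * face_monomial F >].

Fact sr_ideal_idealr : idealr_closed sr_ideal.
Proof.
split.
- by apply/asboolP; exists (fun=> 0); rewrite big1 // => F _; rewrite mul0r.
- apply/negP => /asboolP[c] /(congr1 (mpoly.meval (fun=> 0))) /eqP.
  rewrite mpoly.meval1 rmorph_sum /= big_seq big1 ?oner_eq0 // => F.
  rewrite mem_filter fpowersetE => /andP[FD sF].
  have [F0|[v vF]] := fset_0Vmem F; first by rewrite F0 faces_fset0 in FD.
  rewrite mpoly.mevalM /face_monomial.
  rewrite (bigD1 [` fsubsetP sF v vF]%fset) //= mpoly.mevalM mpoly.mevalXU.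
  by rewrite mul0r mulr0.
- move=> a p q /asboolP[c ->] /asboolP[c' ->]; apply/asboolP.
  exists (fun F => a * c F + c' F); rewrite mulr_sumr -big_split /=.
  by apply: eq_bigr => F _; rewrite mulrDl mulrA.
Qed.

HB.instance Definition _ := isIdealr.Build vertex_poly sr_ideal sr_ideal_idealr.

Definition sr_ring := {ideal_quot sr_ideal}.
HB.instance Definition _ := GRing.ComNzRing.on sr_ring.

Definition sr_pi : vertex_poly -> sr_ring := \pi_sr_ring.

Definition sr_scale (a : K) (q : sr_ring) : sr_ring := sr_pi a%:MP * q.

Fact sr_scaleA a b q : sr_scale a (sr_scale b q) = sr_scale (a * b) q.
Proof. by rewrite /sr_scale mulrA /sr_pi -rmorphM /= mpolyCM. Qed.
Fact sr_scale1 : left_id 1 sr_scale.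
Proof. by move=> q; rewrite /sr_scale /sr_pi rmorph1 mul1r. Qed.
Fact sr_scaleDr : right_distributive sr_scale +%R.
Proof. by move=> a q r; rewrite /sr_scale mulrDr. Qed.
Fact sr_scaleDl q : {morph sr_scale^~ q : a b / a + b}.
Proof. by move=> a b; rewrite /sr_scale /sr_pi mpolyCD rmorphD mulrDl. Qed.

HB.instance Definition _ := GRing.Zmodule_isLmodule.Build K sr_ring
  sr_scaleA sr_scale1 sr_scaleDr sr_scaleDl.

(* The degree-d component of K[D] is the image of the homogeneous polynomials
   of degree d. *)
Definition sr_component (d : nat) (q : sr_ring) : Prop :=
  exists2 p : vertex_poly, p \is d.-homog & q = sr_pi p.

Definition hilbert_series : fps int := fun d => (dim (sr_component d))%:Z.

End StanleyReisner.

(* Main.v *)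
Require Import Defs.
From mathcomp Require Import all_boot all_order all_algebra.
From mathcomp Require Import finmap mpoly boolp.

(** A Stanley-Reisner ideal is spanned, as a vector space, by the monomials
    whose support is not a face, because such a monomial is divisible by the
    squarefree monomial of its own support ([sr_idealP]). Hence the monomials
    of degree [d] supported on a face form a basis of the degree-[d] component
    of the quotient, and the Hilbert function merely counts them
    ([has_dim_sr_component], [hilbert_seriesE]).

    Exponents are encoded as finitely supported functions on the ambient type
    of vertices, so that monomials of polynomial rings in different variables
    are compared inside a single type. Whether such a function is counted
    depends only on whether its support is a face, so the count for a union of
    complexes is a union of sets ([face_exponents_union]) and
    inclusion-exclusion applies. Complexes with disjoint vertex sets share only
    the empty face, which supports only the monomial 1: the overlap has one
    element in degree 0 and none elsewhere ([card_face_exponents_disjoint]),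
    and this is the series 1 that gets subtracted. *)

Set Implicit Arguments.
Unset Strict Implicit.
Unset Printing Implicit Defensive.

Import GRing.Theory.
Local Open Scope fset_scope.
Local Open Scope ring_scope.

Section Exponents.
Variables (T : choiceType) (D : simplicial_complex T).

Local Notation V := (vertices D).
Local Notation mono := 'X_{1..#|{: V}|}.

(** The exponent of a monomial as a function on all of [T], zero off the
    vertices: it no longer refers to the numbering of the variables, which
    changes from one complex to another. *)
Definition exponent (m : mono) : {fsfun T -> nat with 0%N} :=
  [fsfun v : V => m (enum_rank v)].

Definition supp_face (m : mono) : bool := finsupp (exponent m) \in faces D.

Definition total_degree (s : {fsfun T -> nat with 0%N}) : nat :=
  (\sum_(v <- finsupp s) s v)%N.

Lemma exponent_val (m : mono) (v : V) : exponent m (val v) = m (enum_rank v).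
Proof. by rewrite fsfun_ffun valK. Qed.

Lemma exponent_inj : injective exponent.
Proof.
move=> m m' /fsfunP mm'; apply/mnmP => i.
by rewrite -[i]enum_valK -!exponent_val mm'.
Qed.

Lemma finsupp_exponent (m : mono) : finsupp (exponent m) `<=` V.
Proof. exact: finsupp_sub. Qed.

Lemma exponent_surj (s : {fsfun T -> nat with 0%N}) :
  finsupp s `<=` V -> exists m, s = exponent m.
Proof.
move=> /fsubsetP sV; exists [multinom s (val (enum_val i)) | i < #|{: V}|].
apply/fsfunP => v; have [vV|vV] := boolP (v \in V).
  by rewrite -[v]/(val [` vV]) exponent_val mnmE enum_rankK.
have sv : v \notin finsupp s by apply: contra vV; apply: sV.
rewrite !fsfun_dflt //; apply: contra vV.
exact: (fsubsetP (finsupp_exponent _)).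
Qed.

Lemma total_degree_exponent (m : mono) : total_degree (exponent m) = mdeg m.
Proof.
rewrite /total_degree (big_fset_incl _ (finsupp_exponent m)); last first.
  by move=> v _ /fsfun_dflt.
rewrite big_seq_fsetE mdegE [RHS](reindex enum_rank); last first.
  by apply: onW_bij; apply: enum_rank_bij.
by apply: eq_bigr => v _; rewrite exponent_val.
Qed.

(** Bounding the degree by [d.+1] only serves to obtain a finite type to
    range over; [mem_face_exponents] is the intended description. *)
Definition face_exponents (d : nat) : {fset {fsfun T -> nat with 0%N}} :=
  [fset exponent (bmnm m) | m : 'X_{1..#|{: V}| < d.+1}
                          & (mdeg m == d) && supp_face m].

(** The description mentions [D] only through its faces: exponents supported
    on a face automatically live on the vertices. *)
Lemma mem_face_exponents d s :
  (s \in face_exponents d) = (finsupp s \in faces D) && (total_degree s == d).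
Proof.
apply/imfsetP/andP => /= [[m /andP[/eqP md mD] ->]|[sD /eqP sd]].
  by rewrite total_degree_exponent md.
have [m Em] := exponent_surj (faces_vertices sD).
have md : mdeg m = d by rewrite -sd Em total_degree_exponent.
have ltm : (mdeg m < d.+1)%N by rewrite md.
by exists (BMultinom ltm) => //=; rewrite inE /= md eqxx /supp_face -Em.
Qed.

End Exponents.

Section Basis.
Variables (K : fieldType) (T : choiceType) (D : simplicial_complex T).

Local Notation V := (vertices D).
Local Notation mono := 'X_{1..#|{: V}|}.

Definition face_mnm (F : {fset T}) : mono :=
  (\sum_(v : V | val v \in F) U_(enum_rank v))%MM.

Lemma face_monomialE F : face_monomial K D F = 'X_[face_mnm F].
Proof. by rewrite /face_monomial mprodXE. Qed.

Lemma face_mnmE F (v : V) : face_mnm F (enum_rank v) = (val v \in F).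
Proof.
rewrite mnm_sumE big_mkcond (bigD1 v) //= mnm1E eqxx.
rewrite big1 ?addn0 => [|w wv]; first by case: ifP.
by rewrite mnm1E (inj_eq enum_rank_inj) (negPf wv) if_same.
Qed.

Lemma face_mnm_le F (m : mono) : F `<=` V ->
  (face_mnm F <= m)%MM = (F `<=` finsupp (exponent m)).
Proof.
move=> /fsubsetP FV; apply/mnm_lepP/fsubsetP => [Fm v vF|Fm i].
  rewrite mem_finsupp -[v]/(val [` FV v vF]) exponent_val -lt0n.
  by apply: leq_trans (Fm (enum_rank [` FV v vF])); rewrite face_mnmE vF.
rewrite -[i]enum_valK face_mnmE; have [/Fm|//] := boolP (_ \in F).
by rewrite mem_finsupp exponent_val lt0n.
Qed.

Lemma sr_ideal_face_monomial F : F \in nonfaces D ->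
  face_monomial K D F \in @sr_ideal K T D.
Proof.
move=> FD; apply/asboolP; exists (fun G => (G == F)%:R).
rewrite (bigD1_seq F) ?filter_uniq ?fset_uniq //= eqxx mul1r big1 ?addr0 //.
by move=> G /negPf->; rewrite mul0r.
Qed.

(** One inclusion holds because every monomial of a multiple of a nonface
    monomial has a support containing that nonface, and faces are closed under
    taking subsets. For the other, the support of each monomial of [p] is
    itself one of the nonfaces generating the ideal. *)
Lemma sr_idealP (p : vertex_poly K D) :
  reflect (forall m, supp_face m -> p@_m = 0) (p \in @sr_ideal K T D).
Proof.
apply: (iffP idP) => [/asboolP[c ->] m mD|p0].
  (* No term of the sum contributes: a monomial of c F * x_F is divisible by
     x_F, whereas a face contains no nonface. *)
  rewrite raddf_sum /= big_seq big1 // => F.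
  rewrite mem_filter fpowersetE => /andP[FD FV].
  apply/eqP; rewrite mcoeff_eq0 face_monomialE (perm_mem (msuppMX _ _)).
  apply: contra FD => /mapP[k _ Em]; apply: faces_closed mD _.
  by rewrite -face_mnm_le // Em lem_addr.
rewrite [p]mpolyE big_seq rpred_sum // => m.
rewrite -mul_mpolyC mcoeff_msupp => pm; apply: idealMr.
have mD : finsupp (exponent m) \in nonfaces D.
  rewrite mem_filter fpowersetE finsupp_exponent andbT.
  by apply: contra_neqN pm; apply: p0.
rewrite -(@submK _ (face_mnm (finsupp (exponent m))) m).
  by rewrite mpolyXD -face_monomialE idealMr ?sr_ideal_face_monomial.
by rewrite face_mnm_le ?finsupp_exponent.
Qed.

Lemma sr_pi_eq (p q : vertex_poly K D) :
  (sr_pi p = sr_pi q) <-> (p - q \in @sr_ideal K T D).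
Proof.
by rewrite (Quotient.idealrBE (@sr_ideal K T D)); split => [/eqP|/eqP].
Qed.

Lemma sr_pi_lincomb n (c : 'I_n -> K) (p : 'I_n -> vertex_poly K D) :
  \sum_i c i *: sr_pi (p i) = sr_pi (\sum_i c i *: p i).
Proof.
rewrite [RHS]rmorph_sum; apply: eq_bigr => i _.
by rewrite -mul_mpolyC [RHS]rmorphM.
Qed.

Lemma mcoeff_lincomb n (c : 'I_n -> K) (m : 'I_n -> mono) j : injective m ->
  (\sum_i c i *: 'X_[m i] : vertex_poly K D)@_(m j) = c j.
Proof.
move=> m_inj; rewrite raddf_sum (bigD1 j) //= mcoeffZ mcoeffX eqxx mulr1.
rewrite big1 ?addr0 // => i ij.
by rewrite mcoeffZ mcoeffX (inj_eq m_inj) (negPf ij) mulr0.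
Qed.

(** The monomials of degree [d] supported on a face form a basis. Both
    freeness and generation reduce to [sr_idealP]: an element of the ideal has
    zero coefficient on each of them, and a homogeneous polynomial is congruent
    to its part supported on them. *)
Lemma has_dim_sr_component d :
  has_dim (sr_component (K := K) (D := D) d) #|` face_exponents D d|.
Proof.
set E := face_exponents D d.
(* [m] enumerates the basis monomials in the polynomial ring of [D]. *)
have /fin_all_exists[m mE] : forall i : 'I_#|` E|,
    exists m : mono, exponent m = val (enum_val (cast_ord (cardfE E) i)).
  move=> i; set s := enum_val _; have := valP s.
  rewrite mem_face_exponents => /andP[/faces_vertices sV _].
  by have [m ->] := exponent_surj sV; exists m.
have m_inj : injective m.
  move=> i j /(congr1 (@exponent _ _)); rewrite !mE.
  by move/val_inj/enum_val_inj/cast_ord_inj.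
have mP i : supp_face (m i) && (mdeg (m i) == d).
  by rewrite /supp_face -total_degree_exponent -mem_face_exponents mE; apply: valP.
have m_surj k : supp_face k -> mdeg k = d -> exists i, k = m i.
  move=> kD kd; have kE : exponent k \in E.
    by rewrite mem_face_exponents total_degree_exponent kd eqxx andbT.
  exists (cast_ord (esym (cardfE E)) (enum_rank [` kE])).
  by apply: (@exponent_inj _ D); rewrite mE cast_ordKV enum_rankK.
exists (fun i => sr_pi 'X_[m i]); split.
- by move=> i; exists 'X_[m i] => //; rewrite dhomogX; case/andP: (mP i).
- move=> c c0 j; have {c0} : sr_pi (\sum_i c i *: 'X_[m i] : vertex_poly K D) = sr_pi 0.
    by rewrite -sr_pi_lincomb c0 /sr_pi rmorph0.
  move/sr_pi_eq; rewrite subr0 => /sr_idealP /(_ (m j)).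
  by rewrite mcoeff_lincomb //; apply; case/andP: (mP j).
- move=> _ [p p_hom ->]; exists (fun i => p@_(m i)).
  rewrite sr_pi_lincomb; apply/sr_pi_eq/sr_idealP => k kD.
  rewrite mcoeffB; have [kd|kd] := eqVneq (mdeg k) d.
    by have [i ->] := m_surj k kD kd; rewrite mcoeff_lincomb ?subrr.
  rewrite (dhomog_nemf_coeff p_hom kd) sub0r raddf_sum big1 ?oppr0 //= => i _.
  rewrite mcoeffZ mcoeffX; case: eqP => [mk|_]; rewrite ?mulr0 //.
  by move: kd; rewrite -mk; case/andP: (mP i) => _ ->.
Qed.

Lemma hilbert_seriesE d :
  hilbert_series K D d = #|` face_exponents D d|%:Z.
Proof. by rewrite /hilbert_series (dimE (has_dim_sr_component d)). Qed.

End Basis.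

Lemma faces_disjoint (T : choiceType) (D D' : simplicial_complex T) :
  [disjoint vertices D & vertices D'] -> faces D `&` faces D' = [fset fset0].
Proof.
move=> /eqP disj; apply/fsetP => F; rewrite !inE.
apply/andP/eqP => [[FD FD']|->]; last by rewrite !faces_fset0.
by apply/eqP; rewrite -fsubset0 -disj fsubsetI !faces_vertices.
Qed.

Lemma face_exponents_union (T : choiceType) (D D' : simplicial_complex T) d :
  face_exponents (complex_union D D') d =
  face_exponents D d `|` face_exponents D' d.
Proof.
by apply/fsetP => s; rewrite inE !mem_face_exponents inE andb_orl.
Qed.

Lemma card_face_exponents_disjoint (T : choiceType)
    (D D' : simplicial_complex T) d : [disjoint vertices D & vertices D'] ->
  #|` face_exponents D d `&` face_exponents D' d| = (d == 0%N).
Proof.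
move=> disj.
(* The support of a common exponent is the empty face. *)
have mem s : (s \in face_exponents D d `&` face_exponents D' d) =
    (s == [fsfun with 0%N]) && (d == 0%N).
  rewrite inE !mem_face_exponents andbACA andbb -in_fsetI faces_disjoint // inE.
  have <- : (finsupp s == fset0) = (s == [fsfun with 0%N]).
    apply/eqP/eqP => [s0|->]; last exact: finsupp0.
    by apply/fsfunP => v; rewrite fsfunE fsfun_dflt ?s0.
  by case: eqP => //= s0; rewrite /total_degree s0 big_seq_fset0 eq_sym.
have [d0|d0] := eqVneq d 0%N.
  apply/eqP/cardfs1P; exists [fsfun with 0%N].
  by apply/fsetP => s; rewrite mem d0 andbT inE.
apply/eqP; rewrite cardfs_eq0; apply/eqP/fsetP => s.
by rewrite mem (negPf d0) andbF.
Qed.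

Theorem proposition4p9 (K : fieldType) (T : choiceType)
    (D D' : simplicial_complex T)
    (disj : [disjoint vertices D & vertices D']%fset) :
  (hilbert_series K (complex_union D D') =
   hilbert_series K D + hilbert_series K D' - 1)%R.
Proof.
apply/eqP; rewrite -subr_eq opprK; apply/eqP/funext => d.
(* Coefficientwise, the identity is inclusion-exclusion for face exponents. *)
suff : hilbert_series K (complex_union D D') d + (d == 0%N)%:R =
       hilbert_series K D d + hilbert_series K D' d by [].
rewrite !hilbert_seriesE face_exponents_union.
by rewrite -(card_face_exponents_disjoint d disj) natz -!PoszD cardfsUI.
Qed.
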